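(* The max-Tucker rank function $r_{max}$ has the max-full-rank-subtensor property. Furthermore, suppose that $m,n_1,\dots,n_m\in\mathbf{N}$, $\mathcal{X}=(x_{i_1\cdots i_m})\in\mathbf{T}(n_1,\dots,n_m)$, and $\mathcal{Y}$ is a maximum full rank subtensor of $\mathcal{X}$ under $r_{max}$. Then there is an index $p$, $1\le p\le m$, such that all the $q$th $p$-rows of $\mathcal{X}$, with $q$ in the mode $p$ index set $T_p$ of $\mathcal{Y}$, are linearly independent, $|T_p|=r_{max}(\mathcal{Y})=r_{max}(\mathcal{X})$, and any $p$-row of $\mathcal{X}$ is a linear combination of all the $q$th $p$-rows of $\mathcal{X}$ with $q\in T_p$.
   Context: $\mathbf{N}$ is the set of positive integers. For $m,n_1,\dots,n_m\in\mathbf{N}$, $\mathbf{T}(n_1,\dots,n_m)$ is the set of real $m$th order tensors $\mathcal{X}=(x_{i_1\cdots i_m})$ of dimension $n_1\times\cdots\times n_m$; $\mathbf{T}$ is the set of all real tensors (all orders $m\ge1$, all dimensions). Subtensors and $p$-rows: a subtensor $\mathcal{Y}$ of $\mathcal{X}\in\mathbf{T}(n_1,\dots,n_m)$ is a tensor of the same order $m$ obtained by choosing nonempty index sets $T_l\subseteq\{1,\dots,n_l\}$, $l=1,\dots,m$, and restricting $\mathcal{X}$ to $T_1\times\cdots\times T_m$; it is an element of $\mathbf{T}(|T_1|,\dots,|T_m|)$, and $T_l$ is called the mode $l$ index set of $\mathcal{Y}$. For $1\le p\le m$ and $1\le q\le n_p$, the $q$th $p$-row of $\mathcal{X}$ is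 the subtensor with $T_p=\{q\}$ and $T_l=\{1,\dots,n_l\}$ for $l\ne p$. Linear independence and linear combinations of $p$-rows are taken in the vector space of tensors of the common dimension of the $p$-rows. Max-Tucker rank: for $\mathcal{X}\in\mathbf{T}(n_1,\dots,n_m)$, the mode-$j$ unfolding $X_{(j)}\in\mathbb{R}^{n_j\times(n_1\cdots n_{j-1}n_{j+1}\cdots n_m)}$ is the matrix whose rows are indexed by $i_j$, whose columns are indexed by the remaining indices, and whose entries are $x_{i_1\cdots i_m}$ (an $n_1\times1$ matrix if $m=1$); $r_{max}(\mathcal{X})$ is the maximum over $j=1,\dots,m$ of the matrix rank of $X_{(j)}$. Full rank: for a tensor rank function $r$ (in particular $r=r_{max}$), a tensor $\mathcal{X}\in\mathbf{T}(n_1,\dots,n_m)$ is of full $r$ rank if $r(\mathcal{X})=n_p$ for some index $p$ with $1\le p\le m$; in addition, zero tensors are regarded as being of full $r$ rank. A subtensor $\mathcal{Y}$ of $\mathcal{X}$ is a maximum full rank subtensor of $\mathcal{X}$ under $r$ if $\mathcal{Y}$ is of full $r$ rank and $r(\mathcal{Y})$ is the maximum of $r$ over all subtensors of $\mathcal{X}$ that are of full $r$ rank. The function $r$ has the max-full-rank-subtensor property if for every $\mathcal{X}\in\mathbf{T}$, $r(\mathcal{X})=r(\mathcal{Y})$ where $\mathcal{Y}$ is a maximum full rank subtensor of $\mathcal{X}$ under $r$.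
   Formalization: The second part fails for X = 0 and for the 3×3×2 tensor x_ijk = a_ij, A = diag(1,1,0); it is proved for Y such that, for some p, the mode-p unfolding of Y has rank r_max(Y) = |T_p|. It is also proved that every nonzero X has such a maximum full rank subtensor Y. *)

(* Defs.v *)
From HB Require Import structures.
From mathcomp Require Import all_boot all_order all_algebra.
From mathcomp Require Import reals.
Set Implicit Arguments.
Unset Strict Implicit.
Unset Printing Implicit Defensive.
Import GRing.Theory.
Local Open Scope ring_scope.

Definition tindex (m : nat) (n : 'I_m -> nat) := {dffun forall l : 'I_m, 'I_(n l)}.

(* [R^o] rather than [R], so that tensors of given dimensions form a vectType *)
Definition tensor (R : realType) (m : nat) (n : 'I_m -> nat) :=
  {ffun tindex n -> R^o}.

Definition tensor_restrict (R : realType) (m : nat) (n k : 'I_m -> nat)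
    (f : forall l : 'I_m, 'I_(k l) -> 'I_(n l)) (X : tensor R n) : tensor R k :=
  [ffun i : tindex k => X [ffun l : 'I_m => f l (i l)]].

Definition index_sets (m : nat) (n : 'I_m -> nat) :=
  forall l : 'I_m, {set 'I_(n l)}.

Definition all_nonempty (m : nat) (n : 'I_m -> nat) (T : index_sets n) : Prop :=
  forall l : 'I_m, T l != set0.

(* [enum_val] lists T l increasingly, hence the order of the indices is kept *)
Definition subtensor (R : realType) (m : nat) (n : 'I_m -> nat)
    (X : tensor R n) (T : index_sets n) : tensor R (fun l => #|T l|) :=
  tensor_restrict (fun l (i : 'I_#|T l|) => enum_val i) X.

Definition prow_dims (m : nat) (n : 'I_m -> nat) (p l : 'I_m) : nat :=
  if l == p then 1%N else n l.

Lemma prow_sel_subproof (m : nat) (n : 'I_m -> nat) (p : 'I_m) (q : 'I_(n p))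
    (l : 'I_m) (i : 'I_(prow_dims n p l)) :
  ((if l == p then val q else val i) < n l)%N.
Proof.
case: i => i /=; rewrite /prow_dims.
by case: eqP => [->|].
Qed.

Definition prow_sel (m : nat) (n : 'I_m -> nat) (p : 'I_m) (q : 'I_(n p))
    (l : 'I_m) (i : 'I_(prow_dims n p l)) : 'I_(n l) :=
  Ordinal (prow_sel_subproof q i).

(* The subtensor with T_p = {q} and T_l full for l <> p. Its dimensions are
   written [prow_dims n p], and not as cardinals of index sets, so that the
   p-rows for different q live in one and the same vector space. *)
Definition p_row (R : realType) (m : nat) (n : 'I_m -> nat)
    (X : tensor R n) (p : 'I_m) (q : 'I_(n p)) : tensor R (prow_dims n p) :=
  tensor_restrict (prow_sel q) X.

(* The columns are indexed by the indices other than the j-th one: in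
   [tindex (prow_dims n j)] the j-th component ranges over a singleton. *)
Definition unfolding (R : realType) (m : nat) (n : 'I_m -> nat)
    (X : tensor R n) (j : 'I_m) : 'M[R]_(n j, #|{: tindex (prow_dims n j)}|) :=
  \matrix_(q, c) p_row X q (enum_val c).

Definition r_max (R : realType) (m : nat) (n : 'I_m -> nat) (X : tensor R n) : nat :=
  \max_(j < m) \rank (unfolding X j).

Definition rank_function (R : realType) :=
  forall (m : nat) (n : 'I_m -> nat), tensor R n -> nat.

Definition full_rank (R : realType) (r : rank_function R) (m : nat)
    (n : 'I_m -> nat) (X : tensor R n) : Prop :=
  X = 0 \/ exists p : 'I_m, r m n X = n p.

Definition max_full_rank_subtensor (R : realType) (r : rank_function R)
    (m : nat) (n : 'I_m -> nat) (X : tensor R n) (T : index_sets n) : Prop :=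
  [/\ all_nonempty T,
      full_rank r (subtensor X T)
    & forall T' : index_sets n, all_nonempty T' ->
        full_rank r (subtensor X T') ->
        (r m _ (subtensor X T') <= r m _ (subtensor X T))%N].

(* All maximum full rank subtensors of X have the same r, so it does not matter
   which one is taken. *)
Definition max_full_rank_subtensor_property (R : realType)
    (r : rank_function R) : Prop :=
  forall (m : nat) (n : 'I_m -> nat) (X : tensor R n),
    (0 < m)%N -> (forall l, 0 < n l)%N ->
    exists2 T : index_sets n,
      max_full_rank_subtensor r X T & r m n X = r m _ (subtensor X T).

Definition p_rows (R : realType) (m : nat) (n : 'I_m -> nat) (X : tensor R n)
    (p : 'I_m) (A : {set 'I_(n p)}) : seq (tensor R (prow_dims n p)) :=
  [seq p_row X q | q <- enum A].

(* X is of full rank because its mode-p unfolding has r_max X = n p independent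
   rows. Being of full r_max rank does not imply this for any p, even when X is
   nonzero: for the 3 x 3 x 2 tensor x_ijk = a_ij with A = diag(1, 1, 0), the
   unfoldings have ranks 2, 2 and 1. *)
Definition full_rank_in_mode (R : realType) (m : nat) (n : 'I_m -> nat)
    (X : tensor R n) (p : 'I_m) : Prop :=
  \rank (unfolding X p) = r_max X /\ r_max X = n p.

(* Main.v *)
Require Import Defs.
From mathcomp Require Import all_boot all_order all_algebra.
From mathcomp Require Import reals.
Set Implicit Arguments.
Unset Strict Implicit.
Unset Printing Implicit Defensive.
Import GRing.Theory.
Local Open Scope ring_scope.


(** If X <> 0 and the mode-p unfolding of X has the maximal rank r, let T_p
    index r independent rows of it and take every other index set full. The
    subtensor Y keeps these r rows entire, and restricting a tensor increases
    no unfolding rank, so r_max Y = r = |T_p|: a full rank subtensor attains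
    r_max X. Conversely, if the mode-p unfolding of a maximum full rank
    subtensor has rank |T_p|, the p-rows of X over T_p are independent already
    after restriction, and they span since |T_p| = r_max X bounds the rank of
    the mode-p unfolding of X. *)

Section Unfolding.
Variables (R : realType) (m : nat).
Implicit Types n k : 'I_m -> nat.

Lemma prow_drop_subproof n (p l : 'I_m) (i : 'I_(n l)) :
  ((if l == p then 0 else val i) < prow_dims n p l)%N.
Proof. by rewrite /prow_dims; case: eqP => // _; exact: ltn_ord. Qed.

(** The column of the mode-[p] unfolding that holds the entry at [i]: the component at [p] collapses
    to 0, the only value left there. With [prow_insert] it splits a multi-index into its row and its
    column. *)
Definition prow_drop n (p : 'I_m) (i : tindex n) : tindex (prow_dims n p) :=
  [ffun l => Ordinal (prow_drop_subproof p (i l))].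

Definition prow_insert n (p : 'I_m) (q : 'I_(n p))
    (c : tindex (prow_dims n p)) : tindex n :=
  [ffun l => prow_sel q (c l)].

Lemma prow_insertE n (p : 'I_m) (q : 'I_(n p)) c : prow_insert q c p = q.
Proof. by apply: val_inj; rewrite ffunE /= eqxx. Qed.

Lemma prow_dropE n (p : 'I_m) (i j : tindex n) :
  (forall l, l != p -> val (i l) = val (j l)) -> prow_drop p i = prow_drop p j.
Proof.
move=> ij; apply/ffunP => l; apply: val_inj; rewrite !ffunE /=.
by case: eqVneq => // /ij.
Qed.

Lemma prow_dropK n (p : 'I_m) (i : tindex n) :
  prow_insert (i p) (prow_drop p i) = i.
Proof.
apply/ffunP => l; apply: val_inj; rewrite !ffunE /=.
by case: eqP => // ->.
Qed.

Lemma prow_insertK n (p : 'I_m) (q : 'I_(n p)) c :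
  prow_drop p (prow_insert q c) = c.
Proof.
apply/ffunP => l; apply: val_inj; rewrite !ffunE /=.
case: (eqVneq l p) => // lp; case: (c l) => x /=.
by rewrite /prow_dims lp eqxx; case: x.
Qed.

Lemma unfolding_insert n (X : tensor R n) (p : 'I_m) q c :
  unfolding X p q c = X (prow_insert q (enum_val c)).
Proof. by rewrite mxE ffunE. Qed.

Lemma unfolding_drop n (X : tensor R n) (p : 'I_m) (i : tindex n) :
  unfolding X p (i p) (enum_rank (prow_drop p i)) = X i.
Proof. by rewrite unfolding_insert enum_rankK prow_dropK. Qed.

Lemma unfolding_restrict n k (f : forall l, 'I_(k l) -> 'I_(n l))
    (X : tensor R n) (p : 'I_m) :
  'I_(k p) ->
  exists g, unfolding (tensor_restrict f X) p = mxsub (f p) g (unfolding X p).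
Proof.
move=> q0.
pose F (q : 'I_(k p)) c : tindex n := [ffun l => f l (prow_insert q c l)].
(* The column map must not depend on the row: [q] changes [F q c] only at [p], which [prow_drop]
   forgets, so the fixed row [q0] yields the right column for every [q]. *)
exists (fun c => enum_rank (prow_drop p (F q0 (enum_val c)))).
apply/matrixP => q c; rewrite unfolding_insert ffunE mxE -/(F q (enum_val c)).
have Fp : F q (enum_val c) p = f p q by rewrite ffunE prow_insertE.
rewrite -Fp (_ : prow_drop p _ = prow_drop p (F q (enum_val c))).
  by rewrite unfolding_drop.
apply: prow_dropE => l lp; rewrite !ffunE; congr (val (f l _)).
by apply: val_inj; rewrite /= (negPf lp).
Qed.

(** The columns stay in place because [prow_drop] forgets the only component that [f] can move. *)
Lemma unfolding_restrict_mode n (f : forall l, 'I_(n l) -> 'I_(n l))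
    (X : tensor R n) (p : 'I_m) :
  (forall l, l != p -> f l =1 id) ->
  unfolding (tensor_restrict f X) p = rowsub (f p) (unfolding X p).
Proof.
move=> fid; apply/matrixP => q c; rewrite unfolding_insert ffunE mxE.
set F : tindex n := [ffun l => _].
have Fp : F p = f p q by rewrite ffunE prow_insertE.
have <- : enum_rank (prow_drop p F) = c.
  rewrite -[RHS]enum_valK -[in RHS](prow_insertK q (enum_val c)).
  by congr enum_rank; apply: prow_dropE => l lp; rewrite ffunE fid.
by rewrite -Fp unfolding_drop.
Qed.

Lemma tensor_restrict_comp n k h (f : forall l, 'I_(k l) -> 'I_(n l))
    (g : forall l, 'I_(h l) -> 'I_(k l)) (X : tensor R n) :
  tensor_restrict g (tensor_restrict f X)
  = tensor_restrict (fun l => f l \o g l) X.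
Proof.
apply/ffunP => i; rewrite !ffunE; congr (X _).
by apply/ffunP => l; rewrite !ffunE.
Qed.

Lemma mxrank_unfolding_restrict n k (f : forall l, 'I_(k l) -> 'I_(n l))
    (X : tensor R n) (p : 'I_m) :
  (\rank (unfolding (tensor_restrict f X) p)
   <= \rank (rowsub (f p) (unfolding X p)))%N.
Proof.
(* With no rows the rank is 0; otherwise some row is available to define the column map. *)
have [kp0|kp0] := posnP (k p).
  by apply: leq_trans (rank_leq_row _) _; rewrite [X in (X <= _)%N]kp0.
have [g ->] := unfolding_restrict f X (Ordinal kp0).
(* Selecting columns, even with repetitions, is right multiplication by a matrix, which cannot raise
   the rank. *)
by rewrite mxsubcr -[rowsub _ _]mulmx1 -mulmx_colsub mulmx1 mxrankM_maxl.
Qed.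

Lemma r_max_restrict n k (f : forall l, 'I_(k l) -> 'I_(n l)) (X : tensor R n) :
  (r_max (tensor_restrict f X) <= r_max X)%N.
Proof.
apply/bigmax_leqP => p _; apply: leq_trans (leq_bigmax p).
by apply: leq_trans (mxrank_unfolding_restrict f X p) (mxrankS (rowsub_sub _ _)).
Qed.

Lemma r_max0 n : r_max (0 : tensor R n) = 0%N.
Proof.
apply/eqP; rewrite -leqn0; apply/bigmax_leqP => p _.
rewrite (_ : unfolding _ _ = 0) ?mxrank0 //.
by apply/matrixP => q c; rewrite unfolding_insert ffunE mxE.
Qed.

Lemma r_max_gt0 n (X : tensor R n) : (0 < m)%N -> X != 0 -> (0 < r_max X)%N.
Proof.
move=> m_gt0; apply: contraNT; rewrite -eqn0Ngt => /eqP rX0; apply/eqP/ffunP => i.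
pose p := Ordinal m_gt0; have: unfolding X p == 0.
  by rewrite -mxrank_eq0 -leqn0 -rX0 (leq_bigmax p).
by move=> /eqP X0; rewrite -(unfolding_drop X p i) X0 mxE ffunE.
Qed.

Lemma subtensor0 n (T : index_sets n) : subtensor (0 : tensor R n) T = 0.
Proof. by apply/ffunP => i; rewrite !ffunE. Qed.

(** [r_max X] bounds [r_max] on all subtensors, so attaining it gives maximality. *)
Lemma max_full_rank_subtensor_eq_r_max n (X : tensor R n) (T : index_sets n) :
  all_nonempty T -> full_rank (@r_max R) (subtensor X T) ->
  r_max (subtensor X T) = r_max X -> max_full_rank_subtensor (@r_max R) X T.
Proof. by move=> T0 fT rT; split=> // T' _ _; rewrite rT r_max_restrict. Qed.

Lemma exists_full_rank_subtensor n (X : tensor R n) :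
  (0 < m)%N -> (forall l, 0 < n l)%N -> X != 0 ->
  exists T : index_sets n, [/\ all_nonempty T,
    r_max (subtensor X T) = r_max X
    & exists p, full_rank_in_mode (subtensor X T) p].
Proof.
move=> m_gt0 n_gt0 X0.
have [|p rXp] := @eq_bigmax _ (fun j => \rank (unfolding X j)).
  by rewrite card_ord.
have r_gt0 : (0 < \rank (unfolding X p))%N.
  by rewrite -rXp -/(r_max X) r_max_gt0.
pose f : 'I_(\rank (unfolding X p)) -> 'I_(n p) := maxrankfun (unfolding X p).
have f_inj : injective f by exact: maxrankfun_inj.
(* Comparing values avoids a transport along [l = p]; for [l != p] the implication is vacuous and
   [T l] is full. *)
pose T : index_sets n :=
  fun l => [set i : 'I_(n l) | (l == p) ==> (val i \in codom (val \o f))].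
have Tp : T p = f @: setT.
  apply/setP => i; rewrite inE eqxx /=.
  apply/codomP/imsetP => [[x /val_inj ->]|].
    by exists x.
  by case=> x _ ->; exists x.
have T0 l : exists i, i \in T l.
  have [->|lp] := eqVneq l p; last first.
    by exists (Ordinal (n_gt0 l)); rewrite inE (negPf lp).
  by exists (f (Ordinal r_gt0)); rewrite Tp imset_f.
(* [s l] inverts [enum_val] on [T l] and takes a default value elsewhere. Restricting the subtensor
   along [s] returns to the dimensions of [X], where unfoldings have the same columns; this cannot
   raise the rank, so it suffices to bound the rank of the result from below. *)
pose s l : 'I_(n l) -> 'I_#|T l| := enum_rank_in (xchooseP (T0 l)).
have rankT : (\rank (unfolding X p) <= \rank (unfolding (subtensor X T) p))%N.
  have sK l : {in T l, cancel (s l) enum_val} by exact: enum_rankK_in.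
  apply: leq_trans (leq_trans (mxrank_unfolding_restrict s (subtensor X T) p)
    (mxrankS (rowsub_sub _ _))).
  rewrite tensor_restrict_comp unfolding_restrict_mode; last first.
    by move=> l lp i /=; rewrite sK // inE (negPf lp).
  (* The composite restriction fixes each index [f i], so the chosen independent rows all survive
     among its rows. *)
  have /eqP <- := maxrowsub_free (unfolding X p); apply: mxrankS.
  by apply: (submx_rowsub f) => i /=; rewrite sK // Tp imset_f.
have cardTp : #|T p| = \rank (unfolding X p).
  by rewrite Tp card_imset // cardsT card_ord.
have rT : r_max (subtensor X T) = r_max X.
  apply/eqP; rewrite eqn_leq r_max_restrict /= {1}/r_max rXp.
  exact: leq_trans rankT (leq_bigmax p).
exists T; split=> //; first by move=> l; apply/set0Pn; exact: T0.
exists p; split; rewrite rT /r_max rXp // -cardTp.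
by apply/eqP; rewrite eqn_leq rank_leq_row [X in (X <= _)%N]cardTp.
Qed.

Lemma p_row_unfolding n (X : tensor R n) (p : 'I_m) q
    (c : tindex (prow_dims n p)) :
  p_row X q c = unfolding X p q (enum_rank c).
Proof. by rewrite mxE enum_rankK. Qed.

Lemma nth_p_rows n (X : tensor R n) (p : 'I_m) (A : {set 'I_(n p)}) (i : 'I_#|A|) :
  (p_rows X A)`_i = p_row X (enum_val i).
Proof. by rewrite (nth_map (enum_val i)) -?cardE // -enum_val_nth. Qed.

Lemma size_p_rows n (X : tensor R n) (p : 'I_m) (A : {set 'I_(n p)}) :
  size (p_rows X A) == #|A|.
Proof. by rewrite size_map -cardE. Qed.

(** Read entry by entry, a vanishing combination of these p-rows is a row vector annihilating the
    selected rows of the unfolding. *)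
Lemma free_p_rows n (X : tensor R n) (p : 'I_m) (A : {set 'I_(n p)}) :
  row_free (rowsub (@enum_val _ (mem A)) (unfolding X p)) -> free (p_rows X A).
Proof.
move=> frX; apply/(@freeP _ _ _ (Tuple (size_p_rows X A))) => k k0 i /=.
have: \row_j k j *m rowsub (@enum_val _ (mem A)) (unfolding X p) = 0.
  apply/rowP => c; rewrite !mxE.
  move/ffunP/(_ (enum_val c)): k0; rewrite sum_ffunE ffunE => k0c; rewrite -[RHS]k0c.
  apply: eq_bigr => j _; rewrite nth_p_rows ffunE p_row_unfolding enum_valK.
  by rewrite !mxE.
move/eqP; rewrite mulmx_free_eq0 // => /eqP/rowP/(_ i).
by rewrite !mxE.
Qed.

Lemma span_p_rows n (X : tensor R n) (p : 'I_m) (A : {set 'I_(n p)}) q :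
  (unfolding X p <= rowsub (@enum_val _ (mem A)) (unfolding X p))%MS ->
  p_row X q \in <<p_rows X A>>%VS.
Proof.
move=> /(submx_trans (row_sub q _)) /submxP[D XD].
rewrite (_ : p_row X q = \sum_j D 0 j *: p_row X (enum_val j)).
  apply: memv_suml => j _; apply: memvZ; apply: memv_span.
  by apply/mapP; exists (enum_val j); rewrite // mem_enum enum_valP.
apply/ffunP => c; rewrite sum_ffunE p_row_unfolding.
move/rowP/(_ (enum_rank c)): XD; rewrite !mxE => ->.
by apply: eq_bigr => j _; rewrite ffunE p_row_unfolding !mxE.
Qed.
End Unfolding.

Theorem theorem4p3 (R : realType) :
  [/\ max_full_rank_subtensor_property (@r_max R),
      forall (m : nat) (n : 'I_m -> nat) (X : tensor R n) (T : index_sets n),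
        (0 < m)%N -> (forall l, 0 < n l)%N ->
        max_full_rank_subtensor (@r_max R) X T ->
        (exists p : 'I_m, full_rank_in_mode (subtensor X T) p) ->
        exists p : 'I_m,
          [/\ free (p_rows X (T p)),
              #|T p| = r_max (subtensor X T),
              r_max (subtensor X T) = r_max X
            & forall q : 'I_(n p), p_row X q \in <<p_rows X (T p)>>%VS]
    & forall (m : nat) (n : 'I_m -> nat) (X : tensor R n),
        (0 < m)%N -> (forall l, 0 < n l)%N -> X != 0 ->
        exists T : index_sets n,
          max_full_rank_subtensor (@r_max R) X T /\
          exists p : 'I_m, full_rank_in_mode (subtensor X T) p].
Proof.
split=> [m n X m_gt0 n_gt0|m n X T m_gt0 n_gt0 [_ _ maxT] [p [rTp rT]]
        |m n X m_gt0 n_gt0 X0].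
- have [->|X0] := eqVneq X 0.
    (* Choosing [r_max X = 0] rows would leave an empty index set, so full sets are taken; zero
       tensors are of full rank by convention. *)
    exists (fun=> setT); last by rewrite subtensor0 !r_max0.
    apply: max_full_rank_subtensor_eq_r_max; last by rewrite subtensor0 !r_max0.
      by move=> l; apply/set0Pn; exists (Ordinal (n_gt0 l)).
    by left; rewrite subtensor0.
  have [T [T0 rT [p [_ fT]]]] := exists_full_rank_subtensor m_gt0 n_gt0 X0.
  by exists T => //; apply: max_full_rank_subtensor_eq_r_max => //; right; exists p.
- have rTX : r_max (subtensor X T) = r_max X.
    apply/eqP; rewrite eqn_leq r_max_restrict.
    have [->|X0] := eqVneq X 0; first by rewrite r_max0.
    (* Maximality of [T] is tested against a full rank subtensor that attains [r_max X]. *)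
    have [T' [T'0 <- [p' [_ fT']]]] := exists_full_rank_subtensor m_gt0 n_gt0 X0.
    by apply: maxT => //; right; exists p'.
  have rA : \rank (rowsub (@enum_val _ (mem (T p))) (unfolding X p)) = #|T p|.
    apply/eqP; rewrite eqn_leq rank_leq_row -[X in (X <= _)%N]rT -rTp.
    exact: mxrank_unfolding_restrict.
  exists p; split=> //; first by apply: free_p_rows; rewrite /row_free rA.
  (* The row space of the selected rows lies in that of the whole unfolding, so equality of ranks
     makes the two coincide. *)
  move=> q; apply: span_p_rows; rewrite -mxrank_leqif_sup ?rowsub_sub //.
  by rewrite eqn_leq mxrankS ?rowsub_sub // rA -rT rTX (leq_bigmax p).
- have [T [T0 rT [p fT]]] := exists_full_rank_subtensor m_gt0 n_gt0 X0.
  exists T; split; last by exists p.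
  by apply: max_full_rank_subtensor_eq_r_max => //; right; exists p; case: fT.
Qed.
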